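(* Let $H(x)>0$ ($x\ge 0$) be an $m\times m$ matrix function (a Hamiltonian), and let $A$, $S(0)$ be $n\times n$ matrices and $\Pi(0)$ an $n\times m$ matrix such that $S(0)>0$ and $$AS(0)-S(0)A^*=\mathrm{i}\,\Pi(0)\,j\,\Pi(0)^*.$$ Let the matrix functions $\Pi(x)$ ($n\times m$), $S(x)$ ($n\times n$) and $u(x)$ ($m\times m$), $x\ge0$, be determined by the given initial values $\Pi(0)$, $S(0)$ and by $$\Pi'(x)=-\mathrm{i}A\Pi(x)jH(x),\qquad S'(x)=\Pi(x)jH(x)j\Pi(x)^*,$$ $$u'(x)=-\widetilde q_0(x)u(x),\qquad u(0)=I_m,$$ where $$\widetilde q_0(x):=j\Pi(x)^*S(x)^{-1}\Pi(x)jH(x)-jH(x)j\Pi(x)^*S(x)^{-1}\Pi(x),$$ and set $$Y(x,t):=u(x)^*H(x)j\Pi(x)^*S(x)^{-1}\mathrm{e}^{\mathrm{i}tA},\qquad \mathcal H(x):=u(x)^{-1}H(x)^{-1}\big(u(x)^*\big)^{-1}.$$ For $h\in\mathbb C^n$ and an interval $0\le x\le a$, let the energy $E_{Yh}(t)\ge0$ of $Y(x,t)h$ be defined by $$E_{Yh}(t)^2=\int_0^a h^*Y(x,t)^*\mathcal H(x)Y(x,t)h\,dx.$$ Then $$E_{Yh}(t)=\sqrt{h^*\mathrm{e}^{-\mathrm{i}tA^*}\big(S(0)^{-1}-S(a)^{-1}\big)\mathrm{e}^{\mathrm{i}tA}h}.$$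
   Context: All matrices are complex; $n\in\mathbb N$; $m_1\ge0$, $m_2\ge0$, $m=m_1+m_2>0$; $I_p$ is the $p\times p$ identity matrix; $j=\begin{bmatrix} I_{m_1}&0\\0&-I_{m_2}\end{bmatrix}$. $M^*$ is the conjugate transpose of $M$, and $M>0$ (resp. $M\ge 0$) means $M$ is Hermitian positive definite (resp. positive semidefinite). A prime denotes $d/dx$. $\Pi$, $S$, $u$ are understood as (differentiable) solutions on $x\ge0$ of the stated differential equations. Since $S(0)>0$ and $S'(x)\ge0$, the matrices $S(x)$ are positive definite, hence invertible. The matrix $u(x)$ satisfies $u(x)^*ju(x)=j$, so it is invertible. *)

(* Defs.v *)
From HB Require Import structures.
From mathcomp Require Import all_boot all_order all_algebra.
From mathcomp Require Import complex.
From mathcomp Require Import all_classical all_reals all_analysis.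

Set Implicit Arguments.
Unset Strict Implicit.
Unset Printing Implicit Defensive.

Import Order.TTheory GRing.Theory Num.Theory.
Import numFieldNormedType.Exports.

Local Open Scope classical_set_scope.
Local Open Scope ring_scope.
Local Open Scope sesquilinear_scope.

(* The bare type R[i] carries no topology.  MathComp-Analysis equips the carrier
   of every structure of type numClosedFieldType with its norm topology, and
   matrices over it with the corresponding (sup) norm, hence this bundling. *)
Definition Cplx (R : realType) : numClosedFieldType := R[i].

Definition ofR (R : realType) (x : R) : Cplx R := x%:C%C.

Definition posdef (R : realType) (p : nat) (M : 'M[Cplx R]_p) : Prop :=
  M \is hermsymmx /\
  forall v : 'cV[Cplx R]_p, v != 0 -> 0 < (v^t* *m M *m v) 0 0.

(* f is differentiable on the half-line [0, +oo[ with derivative f'.  The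
   increment h is restricted to 0 <= x + h, so the derivative is two-sided for
   0 < x and one-sided at x = 0; values of f at negative reals are irrelevant. *)
Definition has_derivative_ge0 (R : realType) (p q : nat)
    (f f' : R -> 'M[Cplx R]_(p, q)) : Prop :=
  forall x : R, 0 <= x ->
    (ofR h)^-1 *: (f (x + h) - f x)
      @[h --> within [set h : R | 0 <= x + h] 0^'] --> f' x.

Definition expmx (R : realType) (p : nat) (M : 'M[Cplx R]_p) : 'M[Cplx R]_p :=
  limn (series (fun k : nat => (k`!%:R)^-1 *: (M ^+ k))).

Section Objects.
Variables (R : realType) (n m1 m2 : nat).

Definition jmx : 'M[Cplx R]_(m1 + m2) := block_mx 1%:M 0 0 (- 1%:M).

Definition q0_tilde (H : R -> 'M[Cplx R]_(m1 + m2))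
    (Pi : R -> 'M[Cplx R]_(n, m1 + m2)) (S : R -> 'M[Cplx R]_n) (x : R)
    : 'M[Cplx R]_(m1 + m2) :=
  jmx *m (Pi x)^t* *m invmx (S x) *m Pi x *m jmx *m H x
  - jmx *m H x *m jmx *m (Pi x)^t* *m invmx (S x) *m Pi x.

Definition Ymx (A : 'M[Cplx R]_n) (H u : R -> 'M[Cplx R]_(m1 + m2))
    (Pi : R -> 'M[Cplx R]_(n, m1 + m2)) (S : R -> 'M[Cplx R]_n) (x t : R)
    : 'M[Cplx R]_(m1 + m2, n) :=
  (u x)^t* *m H x *m jmx *m (Pi x)^t* *m invmx (S x)
    *m expmx (('i * ofR t) *: A).

Definition calH (H u : R -> 'M[Cplx R]_(m1 + m2)) (x : R)
    : 'M[Cplx R]_(m1 + m2) :=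
  invmx (u x) *m invmx (H x) *m invmx ((u x)^t*).

End Objects.

(* Integrand y(x)^* K(x) y(x) of the energy of a vector function y with respect
   to a Hamiltonian K.  It is real whenever K(x) is Hermitian, in particular for
   K = calH H u with H > 0 and u invertible. *)
Definition energy_density (R : realType) (m : nat) (K : R -> 'M[Cplx R]_m)
    (y : R -> 'cV[Cplx R]_m) (x : R) : R :=
  complex.Re (((y x)^t* *m K x *m y x) 0 0).

Definition energy (R : realType) (m : nat) (a : R) (K : R -> 'M[Cplx R]_m)
    (y : R -> 'cV[Cplx R]_m) : R :=
  Num.sqrt (\int[lebesgue_measure]_(x in `[0, a]) energy_density K y x).

(* Main.v *)
Require Import Defs.
From mathcomp Require Import all_boot all_order all_algebra.
From mathcomp Require Import complex measurable_realfun lra ring.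
From mathcomp Require Import all_classical all_reals all_analysis.

Import Order.TTheory GRing.Theory Num.Theory.
Import numFieldNormedType.Exports.

Local Open Scope classical_set_scope.
Local Open Scope ring_scope.
Local Open Scope sesquilinear_scope.

(* Since u^* j u is constant, u(x) is invertible, and the energy density reduces
   to b^* S^-1 Pi j H j Pi^* S^-1 b with b = e^{itA} h, which is minus the
   derivative of b^* S^-1 b; here S is Hermitian, and invertible because
   v^* S v is nondecreasing for every v.  As H need not be continuous (nor even
   measurable a priori), integrating this derivative requires the fundamental
   theorem of calculus for a function differentiable everywhere with a
   nonnegative derivative.  The latter follows from the inequality
   F(a) - F(0) <= int_0^a g for measurable g >= 0, g >= F', applied to F and to
   the functions N x - F(x), N -> oo. *)

Lemma locally_nondecreasing_le {R : realType} (a : R) (phi : R -> R) : 0 <= a ->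
  (forall x : R, 0 <= x <= a -> exists2 d : R, 0 < d & forall y : R, 0 <= y <= a ->
    `|y - x| < d -> (x <= y -> phi x <= phi y) /\ (y <= x -> phi y <= phi x)) ->
  phi 0 <= phi a.
Proof.
move=> a0 Hloc.
pose A := [set x | 0 <= x <= a /\ phi 0 <= phi x].
have A0 : A 0 by split=> //; rewrite lexx.
have hsA : has_sup A by split; [exists 0|exists a => x [/andP[]]].
have s0 : 0 <= sup A by apply: sup_upper_bound.
have sa : sup A <= a by apply: ge_sup; [exists 0|move=> x [/andP[]]].
have sI : 0 <= sup A <= a by rewrite s0 sa.
have [d d0 Hd] := Hloc _ sI.
have As : phi 0 <= phi (sup A).
  have [x [x0a px] sx] := sup_adherent d0 hsA.
  have xs : x <= sup A by apply: sup_upper_bound.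
  apply: (le_trans px); apply: (Hd x x0a _).2 => //.
  by rewrite distrC ger0_norm ?subr_ge0//; lra.
have [->//|sna] := eqVneq a (sup A).
have slta : sup A < a by rewrite lt_neqAle eq_sym sna.
pose y := Num.min a (sup A + d / 2).
have ya : y <= a by rewrite /y ge_min lexx.
have sy : sup A < y by rewrite /y lt_min slta/=; lra.
have yd : y <= sup A + d / 2 by rewrite /y ge_min lexx orbT.
have y0a : 0 <= y <= a by rewrite ya (le_trans s0) ?ltW.
have : A y.
  split => //; apply: (le_trans As); apply: (Hd y y0a _).1 => //; last exact: ltW.
  by rewrite ger0_norm; lra.
by move/(sup_upper_bound hsA); lra.
Qed.

Definition real_derivative_ge0 {R : realType} (F dF : R -> R) :=
  forall x : R, 0 <= x -> forall e : R, 0 < e -> exists2 d : R, 0 < d &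
    forall y : R, 0 <= y -> `|y - x| < d ->
      `|F y - F x - dF x * (y - x)| <= e * `|y - x|.

Lemma integral_itv0_cst {R : realType} (a r : R) : 0 <= a ->
  (\int[lebesgue_measure]_(_ in `[0%R, a]) r%:E = (r * a)%:E)%E.
Proof.
move=> a0; rewrite EFinM (_ : a%:E = lebesgue_measure `[0%R, a]%classic).
  exact: (integral_cst (@lebesgue_measure R) (measurable_itv `[0, a]) r%:E).
rewrite lebesgue_measure_itv/= lte_fin.
case: ltP => Ha; first by rewrite oppr0 addr0.
by congr EFin; apply: le_anti; rewrite a0 Ha.
Qed.

(* With E_k = {k e <= g < (k+1) e} and U_k an open set slightly larger than E_k,
   the measure nu = sum_k (k+1) e mu(U_k & .) dominates (k+1) e mu > g mu near
   each point of E_k, so that x |-> nu ]0, x] - F x is locally nondecreasing,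
   while nu [0, a] exceeds the integral of g by O(e) only. *)
Section increment_le_integral.
Context {R : realType}.
Notation mu := (@lebesgue_measure R).
Variables (F dF g : R -> R) (a : R).
Hypothesis a0 : 0 <= a.
Hypothesis FdF : real_derivative_ge0 F dF.
Hypothesis g0 : forall x : R, 0 <= x <= a -> 0 <= g x.
Hypothesis dFg : forall x : R, 0 <= x <= a -> dF x <= g x.
Hypothesis mg : measurable_fun `[0, a] g.

Let le_mu (A B : set R) :
  measurable A -> measurable B -> A `<=` B -> (mu A <= mu B)%E.
Proof. by move=> mA mB AB; apply: le_measure => //; rewrite inE. Qed.

Section level_cover.
Variable e : R.
Hypothesis e0 : 0 < e.

Let E (k : nat) : set R := `[0, a] `&` g @^-1` `[k%:R * e, k.+1%:R * e[.

Let mE k : measurable (E k).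
Proof. by apply: mg => //; exact: measurable_itv. Qed.

Let bigcupE : \bigcup_k E k = `[0, a]%classic.
Proof.
apply/seteqP; split => [x [k _ []//]|x xa]; have := xa.
rewrite /= in_itv/= => /g0 gx0.
exists (Num.trunc (g x / e)) => //; split => //=.
rewrite in_itv/= -ler_pdivlMr// -ltr_pdivrMr//.
by apply: truncn_itv; rewrite divr_ge0// ltW.
Qed.

Let trivE : trivIset setT E.
Proof.
have truncE k x : E k x -> Num.trunc (g x / e) = k.
  move=> [_ /=]; rewrite in_itv/= -ler_pdivlMr// -ltr_pdivrMr// => ?.
  exact: truncn_def.
by move=> i j _ _ [x [/truncE <- /truncE <-]].
Qed.

Let c (k : nat) : R := k.+1%:R * e.

Let c0 k : 0 <= c k. Proof. by rewrite /c mulr_ge0// ltW. Qed.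

Let sumE : (\sum_(0 <= k <oo) (c k)%:E * mu (E k) <=
  \int[mu]_(x in `[0%R, a]) (g x + e)%:E)%E.
Proof.
rewrite -[in leRHS]bigcupE ge0_integral_bigcup//=; last 2 first.
- rewrite bigcupE; apply/measurable_EFinP; exact: measurable_funD.
- by rewrite bigcupE => x; rewrite /= in_itv/= => /g0 gx; rewrite lee_fin addr_ge0// ltW.
apply: lee_nneseries => [i _ _|k _]; first by rewrite mule_ge0// lee_fin.
have <- := integral_cst mu (mE k) (c k)%:E.
rewrite /cst; apply: ge0_le_integral => //=; first exact: mE.
- by move=> x _; rewrite lee_fin.
- apply/measurable_EFinP; apply: measurable_funD => //.
  by apply: measurable_funS mg => // x [].
- move=> x [_ /=]; rewrite in_itv/= => /andP[gx _].
  by rewrite lee_fin /c -natr1 mulrDl mul1r; lra.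
Qed.

Let eps (k : nat) : R := e / (2 ^ k.+1)%:R / c k.

Let c_gt0 k : 0 < c k. Proof. by rewrite /c mulr_gt0. Qed.

Let eps0 k : 0 < eps k.
Proof. by rewrite !divr_gt0// ltr0n expn_gt0. Qed.

Let exU k : exists U : set R,
  [/\ open U, E k `<=` U & (mu (U `\` E k) < (eps k)%:E)%E].
Proof.
apply: lebesgue_regularity_outer => //.
apply: (@le_lt_trans _ _ (mu `[0%R, a]%classic)).
  by apply: le_mu => // x [].
by rewrite lebesgue_measure_itv/=; case: ifP => _; rewrite ltry.
Qed.

Let U k := sval (cid (exU k)).

Let openU k : open (U k). Proof. by rewrite /U; case: cid => ? []. Qed.

Let EU k : E k `<=` U k. Proof. by rewrite /U; case: cid => ? []. Qed.

Let muU k : (mu (U k `\` E k) < (eps k)%:E)%E.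
Proof. by rewrite /U; case: cid => ? []. Qed.

Let mU k : measurable (U k). Proof. exact: open_measurable. Qed.

Let nu : {measure set (measurableTypeR R) -> \bar R} :=
  mseries (fun k => mscale (NngNum (c0 k)) (mrestr mu (mU k))) 0.

Let nuE A : nu A = (\sum_(0 <= k <oo) (c k)%:E * mu (A `&` U k))%E.
Proof. by []. Qed.

Let le_nu (A B : set R) :
  measurable A -> measurable B -> A `<=` B -> (nu A <= nu B)%E.
Proof. by move=> mA mB AB; apply: le_measure => //; rewrite inE. Qed.

Let nu_le : (nu `[0%R, a]%classic <= \int[mu]_(x in `[0%R, a]) (g x + e)%:E + e%:E)%E.
Proof.
apply: (@le_trans _ _
  (\sum_(0 <= k <oo) ((c k)%:E * mu (E k) + (e / (2 ^ k.+1)%:R)%:E))%E).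
  rewrite nuE; apply: lee_nneseries => [k _ _|k _].
    by rewrite mule_ge0// lee_fin.
  rewrite (_ : (e / (2 ^ k.+1)%:R) = c k * eps k); last first.
    by rewrite /eps [RHS]mulrC divfK// gt_eqF.
  rewrite (EFinM (c k)) -muleDr//; last by rewrite ge0_adde_def// inE// lee_fin ltW.
  rewrite lee_pmul2l ?lte_fin//.
  apply: (@le_trans _ _ (mu (U k))).
    by apply: le_mu => //; exact: measurableI.
  rewrite -[in leLHS](setDUK (EU k)) measureU ?setDIK//.
  - exact: (leeD (lexx (mu (E k))) (ltW (muU k))).
  - exact: mE.
  - exact: (measurableD (mU k) (mE k)).
apply: (le_trans (epsilon_trick _ _ _)); last by rewrite leeD2r.
- by move=> k; rewrite mule_ge0// lee_fin.
- exact: ltW.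
Qed.

Let nu_itv k (x y : R) : x <= y -> `]x, y] `<=` U k ->
  ((c k * (y - x))%:E <= nu `]x, y]%classic)%E.
Proof.
move=> xy xyU; rewrite nuE (nneseriesD1 _ (n := k))//; last first.
  by move=> i _; rewrite mule_ge0// lee_fin.
rewrite -[leLHS]adde0; apply: leeD.
  rewrite setIidl// lebesgue_measure_itv/= lte_fin.
  case: ltP => xy'; rewrite ?lee_fin ?EFinM//.
  by rewrite (_ : y - x = 0) ?mulr0 ?mule0//; lra.
by apply: nneseries_ge0 => i _ _; rewrite mule_ge0// lee_fin.
Qed.

Lemma increment_le_integral_eps :
  ((F a - F 0)%:E <= \int[mu]_(x in `[0%R, a]) (g x + e)%:E + e%:E)%E.
Proof.
apply: le_trans nu_le; rewrite leNgt; apply/negP => nu_lt.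
have nu_fin (x y : R) : 0 <= x -> y <= a -> (nu `]x, y]%classic \is a fin_num)%E.
  move=> x0 ya; rewrite ge0_fin_numE//.
  apply: (@le_lt_trans _ _ (nu `[0%R, a]%classic)); last first.
    by rewrite (lt_trans nu_lt)// ltry.
  apply: le_nu => //= z /=; rewrite !in_itv/=; lra.
pose phi x := fine (nu `]0%R, x]%classic) - F x.
have phiB (x y : R) : 0 <= x -> x <= y -> y <= a ->
    phi y - phi x = fine (nu `]x, y]%classic) - (F y - F x).
  move=> x0 xy ya; rewrite /phi.
  have -> : `]0, y]%classic = `]0, x] `|` `]x, y].
    by rewrite -itv_bndbnd_setU// bnd_simp.
  rewrite measureU//.
    rewrite fineD ?nu_fin//; [lra|exact: le_trans ya].
  by apply/seteqP; split => z //=; rewrite !in_itv/=; lra.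
suff : phi 0 <= phi a.
  rewrite /phi set_itvoc0 measure0/= => H.
  move: nu_lt; rewrite ltNge => /negP; apply.
  apply: (@le_trans _ _ (nu `]0%R, a]%classic)).
    by rewrite -[leRHS]fineK ?nu_fin// lee_fin; lra.
  apply: le_nu => //= z /=; rewrite !in_itv/=; lra.
apply: locally_nondecreasing_le => // x x0a.
have : (\bigcup_k E k) x by rewrite bigcupE /= in_itv.
move=> [k _ Ekx].
have gx : g x < c k by case: Ekx => _ /=; rewrite in_itv/= => /andP[].
have /open_nbhs_nbhs/nbhs_ballP[d1 /= d10 Hd1] := conj (openU k) (EU _ _ Ekx).
have dFx := dFg _ x0a.
have x0 : 0 <= x by case/andP: x0a.
have [|d2 d20 Hd2] := FdF _ x0 (c k - dF x); first by lra.
have key (z w : R) : 0 <= z -> z <= w -> w <= a -> x - d1 < z -> w < x + d1 ->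
    F w - F z <= c k * (w - z) -> phi z <= phi w.
  move=> z0 zw wa zd wd Fzw; rewrite -subr_ge0 phiB//.
  suff : c k * (w - z) <= fine (nu `]z, w]%classic) by lra.
  rewrite -lee_fin fineK ?nu_fin//; apply: nu_itv => // t /=.
  rewrite in_itv/= => tzw; apply: Hd1; rewrite /ball/= ltr_norml; lra.
exists (Num.min d1 d2) => [|y /andP[y0 ya]]; first by rewrite lt_min d10.
rewrite lt_min => /andP[yd1 yd2].
move: (yd1); rewrite ltr_norml => /andP[yd1l yd1r].
have := Hd2 _ y0 yd2; rewrite ler_norml => /andP[Hl Hr].
have xa : x <= a by case/andP: x0a.
split => xy.
  move: Hl Hr; rewrite ger0_norm ?subr_ge0// => Hl Hr.
  by apply: key => //; lra.
move: Hl Hr; rewrite ler0_norm ?subr_le0// mulrN opprK => Hl Hr.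
by apply: key => //; lra.
Qed.

End level_cover.

Lemma increment_le_integral :
  ((F a - F 0)%:E <= \int[mu]_(x in `[0%R, a]) (g x)%:E)%E.
Proof.
apply/lee_addgt0Pr => e e0.
pose e1 := e / (a + 1).
have a1 : 0 < a + 1 by rewrite ltr_wpDl.
have e10 : 0 < e1 by rewrite divr_gt0.
apply: le_trans (increment_le_integral_eps _ e10) _.
under eq_integral do rewrite EFinD.
rewrite ge0_integralD//=; last 2 first.
- exact/measurable_EFinP.
- by move=> x _; rewrite lee_fin ltW.
rewrite integral_itv0_cst// -addeA leeD2l// lee_fin.
by rewrite /e1 -[X in _ + X]mulr1 -mulrDr divfK// gt_eqF.
Qed.

End increment_le_integral.

Section nonneg_derivative_integral.
Context {R : realType}.
Notation mu := (@lebesgue_measure R).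
Variables (F dF : R -> R).
Hypothesis FdF : real_derivative_ge0 F dF.

(* Nothing is known of F on the negative reals, hence the constant extension. *)
Let G (x : R) := F (Num.max 0 x).

Let max0_dist (x y : R) : `|Num.max 0 y - Num.max 0 x| <= `|y - x|.
Proof.
have := ler_norm (y - x); have := ler_norm (x - y); rewrite [`|x - y|]distrC.
by rewrite ler_norml; case: (leP 0 x); case: (leP 0 y); lra.
Qed.

Let continuousG : continuous G.
Proof.
move=> x; apply/cvgrPdist_lt => e e0.
have x0 : 0 <= Num.max 0 x by rewrite le_max lexx.
have [d d0 Hd] := FdF _ x0 1 ltr01.
pose M := `|dF (Num.max 0 x)| + 1.
have M0 : 0 < M by rewrite ltr_wpDl.
apply/nbhs_ballP; exists (Num.min d (e / M)) => /=.
  by rewrite lt_min d0 divr_gt0.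
move=> y; rewrite /ball/= distrC lt_min => /andP[yd yM].
have xy := max0_dist x y.
rewrite /G distrC.
have := Hd (Num.max 0 y) _ (le_lt_trans xy yd).
rewrite le_max lexx => /(_ isT); rewrite mul1r => H.
have {}H := le_trans (ler_dist_dist _ _) H.
have : `|F (Num.max 0 y) - F (Num.max 0 x)| <= M * `|y - x|.
  apply: le_trans (_ : _ <= M * `|Num.max 0 y - Num.max 0 x|) _.
    by move: H; rewrite normrM ler_norml /M mulrDl mul1r; lra.
  by rewrite ler_wpM2l// ltW.
move=> /le_lt_trans; apply.
by rewrite mulrC -ltr_pdivlMr.
Qed.

Lemma measurable_derivative_ge0 (a : R) : measurable_fun `[0, a] dF.
Proof.
pose q (n : nat) x := n.+1%:R * (G (x + n.+1%:R^-1) - G x).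
apply: (@measurable_fun_cvg _ _ _ _ q) => [n|x /=].
  apply: (@measurable_funS _ _ _ _ setT) => //.
  apply: continuous_measurable_fun => x.
  apply: cvgM; first exact: cvg_cst.
  apply: cvgB; last exact: continuousG.
  apply: (cvg_comp (fun x => x + n.+1%:R^-1) G) (continuousG _).
  by apply: cvgD; [exact: cvg_id|exact: cvg_cst].
rewrite in_itv/= => /andP[x0 _]; apply/cvgrPdist_le => e e0.
have [d d0 Hd] := FdF _ x0 e e0.
near=> n.
have n0 : 0 < n.+1%:R^-1 :> R by rewrite invr_gt0.
have nd : n.+1%:R^-1 < d by near: n; exact: (near_infty_natSinv_lt (PosNum d0)).
have xn0 : 0 <= x + n.+1%:R^-1 by rewrite addr_ge0// ltW.
have := Hd _ xn0; rewrite [x + _]addrC addrK gtr0_norm// => /(_ nd) H.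
rewrite distrC /q /G (max_r x0) (max_r xn0).
have -> : n.+1%:R * (F (x + n.+1%:R^-1) - F x) - dF x =
    n.+1%:R * (F (n.+1%:R^-1 + x) - F x - dF x / n.+1%:R).
  by rewrite [x + _]addrC [RHS]mulrBr [_ * (dF x / _)]mulrCA divff ?mulr1.
by rewrite normrM normr_nat mulrC -ler_pdivlMr.
Unshelve. all: by end_near. Qed.

Variable a : R.
Hypothesis a0 : 0 <= a.
Hypothesis dF0 : forall x : R, 0 <= x <= a -> 0 <= dF x.

Let mdF := measurable_derivative_ge0 a.

(* increment_le_integral applied to N x - F x, whose derivative N - dF x is
   bounded by the nonnegative function N - min(dF x, N). *)
Let integral_min_le (N : nat) :
  (\int[mu]_(x in `[0%R, a]) (Num.min (dF x) N%:R)%:E <= (F a - F 0)%:E)%E.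
Proof.
have mmin : measurable_fun `[0, a] (fun x => Num.min (dF x) N%:R).
  by apply: measurable_minr.
have msub : measurable_fun `[0, a] (fun x => N%:R - Num.min (dF x) N%:R).
  exact: measurable_funB.
have min0 (x : R) : 0 <= x <= a -> 0 <= Num.min (dF x) N%:R.
  by move=> /dF0 H; rewrite le_min H/=.
have sub0 (x : R) : 0 <= N%:R - Num.min (dF x) N%:R.
  by rewrite subr_ge0 ge_min lexx orbT.
have H : ((N%:R * a - F a - (N%:R * 0 - F 0))%:E <=
    \int[mu]_(x in `[0%R, a]) (N%:R - Num.min (dF x) N%:R)%:E)%E.
  apply: (@increment_le_integral R (fun x => N%:R * x - F x)
            (fun x => N%:R - dF x)) => //.
    move=> x x0 e e0; have [d d0 Hd] := FdF _ x0 e e0; exists d => // y y0 yx.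
    apply: le_trans (Hd y y0 yx); rewrite -[leLHS]normrN.
    by rewrite le_eqVlt; apply/orP; left; apply/eqP; congr `|_|; ring.
  by move=> x _; rewrite lerB// ge_min lexx.
have H2 : (\int[mu]_(x in `[0%R, a]) (N%:R - Num.min (dF x) N%:R)%:E +
    \int[mu]_(x in `[0%R, a]) (Num.min (dF x) N%:R)%:E = (N%:R * a)%:E)%E.
  rewrite -ge0_integralD//=; last 3 first.
  - by move=> x _; rewrite lee_fin.
  - exact/measurable_EFinP.
  - exact/measurable_EFinP.
  under eq_integral do rewrite -EFinD subrK.
  exact: integral_itv0_cst.
move: H H2; set I1 := integral _ _ _; set I2 := integral _ _ _.
case: I1 => [r| |]; case: I2 => [s| |]//=; rewrite -?EFinD ?lee_fin//.
by move=> + [rs]; rewrite -rs; lra.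
Qed.

Lemma ge0_derivative_integral :
  (\int[mu]_(x in `[0%R, a]) (dF x)%:E = (F a - F 0)%:E)%E.
Proof.
apply/eqP; rewrite eq_le; apply/andP; split; last first.
  by apply: (increment_le_integral F dF).
pose f (N : nat) x := (Num.min (dF x) N%:R)%:E.
have limf x : limn (f ^~ x) = (dF x)%:E.
  apply: cvg_lim => //; apply: cvg_near_cst.
  near=> N; rewrite /f min_l//.
  by near: N; exact: nbhs_infty_ger.
under eq_integral do rewrite -limf.
have mf N : measurable_fun (T:=measurableTypeR R) `[0, a] (f N).
  by apply/measurable_EFinP; exact: measurable_minr.
have f0 N x : `[0, a]%classic x -> (0 <= f N x)%E.
  by rewrite /= in_itv/= => /dF0 H; rewrite lee_fin le_min H/=.
have ndf x : `[0, a]%classic x -> {homo f ^~ x : n m / (n <= m)%N >-> (n <= m)%E}.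
  move=> _ n m nm; rewrite lee_fin le_min ge_min lexx/= ge_min.
  by rewrite ler_nat nm orbT.
have := @cvg_monotone_convergence _ _ _ (@lebesgue_measure R) _
  (measurable_itv `[0, a]) _ mf f0 ndf.
apply: cvge_le.
by near=> N; exact: integral_min_le.
Unshelve. all: by end_near. Qed.

Lemma ge0_derivative_integrable : mu.-integrable `[0%R, a] (EFin \o dF).
Proof.
apply/integrableP; split; first exact/measurable_EFinP.
apply: (@le_lt_trans _ _ (\int[mu]_(x in `[0%R, a]) (dF x)%:E)%E); last first.
  by rewrite ge0_derivative_integral ltry.
rewrite le_eqVlt; apply/orP; left; apply/eqP; apply: eq_integral => x.
by rewrite inE/= in_itv/= => /dF0 H; rewrite ger0_norm.
Qed.

Lemma ge0_derivative_le : F 0 <= F a.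
Proof.
rewrite -subr_ge0 -lee_fin -ge0_derivative_integral.
by apply: integral_ge0 => x; rewrite /= in_itv/= lee_fin; exact: dF0.
Qed.

End nonneg_derivative_integral.

Section matrix_limits.
Context {T : Type} {F : set_system T} {FF : Filter F}.

Lemma cvg_mxP {K : numFieldType} {m n : nat} (f : T -> 'M[K]_(m, n))
    (M : 'M[K]_(m, n)) :
  f x @[x --> F] --> M <-> forall i j, f x i j @[x --> F] --> M i j.
Proof.
split=> [fM i j|fM A [P PM PA]].
  exact: (cvg_comp f (fun N : 'M[K]_(m, n) => N i j) fM (@coord_continuous K m n i j M)).
apply: (filterS (P := [set x | forall i j, P i j (f x i j)])).
  by move=> x Px; exact: PA.
apply: filter_forall => i; apply: filter_forall => j.
exact: fM (PM i j).
Qed.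

Lemma cvg_mulmx {K : numFieldType} {m n p : nat} (f : T -> 'M[K]_(m, n))
    (g : T -> 'M[K]_(n, p)) (A : 'M[K]_(m, n)) (B : 'M[K]_(n, p)) :
  f x @[x --> F] --> A -> g x @[x --> F] --> B -> f x *m g x @[x --> F] --> A *m B.
Proof.
move=> /cvg_mxP fA /cvg_mxP gB; apply/cvg_mxP => i j; rewrite mxE.
under eq_fun do rewrite mxE.
by apply: (cvg_big add_continuous) => k _; apply: cvgM.
Qed.

Lemma cvg_trmxC {C : numClosedFieldType} {m n : nat} (f : T -> 'M[C]_(m, n))
    (A : 'M[C]_(m, n)) :
  f x @[x --> F] --> A -> (f x)^t* @[x --> F] --> A^t*.
Proof.
move=> /cvg_mxP fA; apply/cvg_mxP => i j; rewrite !mxE.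
under eq_fun do rewrite !mxE.
apply/cvgrPdist_le => e e0; have /cvgrPdist_le/(_ e e0) := fA j i.
by apply: filterS => x; rewrite -rmorphB norm_conjC.
Qed.

Lemma cvg_det {K : numFieldType} {n : nat} (f : T -> 'M[K]_n) (A : 'M[K]_n) :
  f x @[x --> F] --> A -> \det (f x) @[x --> F] --> \det A.
Proof.
move=> /cvg_mxP fA; apply: (cvg_big add_continuous) => s _.
apply: cvgM; first exact: cvg_cst.
by apply: (cvg_big mul_continuous) => i _; exact: fA.
Qed.

Lemma cvg_invmx {K : numFieldType} {n : nat} (f : T -> 'M[K]_n) (A : 'M[K]_n) :
  A \in unitmx -> f x @[x --> F] --> A -> invmx (f x) @[x --> F] --> invmx A.
Proof.
move=> uA fA; have dA := cvg_det _ _ fA.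
have dA0 : \det A != 0 by rewrite -unitfE -[_ \is a _]/(A \in unitmx).
have ufF : \forall x \near F, f x \in unitmx.
  have : \forall x \near F, \det (f x) != 0 by exact: cvgr_neq0 dA dA0.
  apply: filterS => x.
  by rewrite unitmxE unitfE.
rewrite /invmx uA.
apply: (cvg_trans (near_eq_cvg (f := fun x => (\det (f x))^-1 *: \adj (f x)) _)).
  by apply: filterS ufF => x ->.
apply: cvgZ; first exact: cvgV.
apply/cvg_mxP => i j; rewrite mxE; under eq_fun do rewrite mxE.
apply: cvgM; first exact: cvg_cst.
apply: cvg_det; apply/cvg_mxP => k l; rewrite !mxE; under eq_fun do rewrite !mxE.
by move/cvg_mxP: fA => fA; exact: fA.
Qed.

End matrix_limits.

Section derivatives.
Context {R : realType}.

Notation W x := (within [set h : R | 0 <= x + h] 0^').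

Lemma near_increment (x : R) (P : set R) : (\forall h \near W x, P h) <->
  exists2 d : R, 0 < d & forall h, `|h| < d -> h != 0 -> 0 <= x + h -> P h.
Proof.
rewrite !near_withinE; split=> [/nbhs_ballP[d /= d0 H]|[d d0 H]].
  by exists d => // h hd; apply: H; rewrite /ball/= sub0r normrN.
apply/nbhs_ballP; exists d => //= h; rewrite /ball/= sub0r normrN.
exact: H.
Qed.

Lemma ofRM (x y : R) : ofR (x * y) = ofR x * ofR y.
Proof. exact: (rmorphM (real_complex R)). Qed.

Lemma norm_ofR (x : R) : `|ofR x| = ofR `|x|.
Proof. by rewrite normc_def /= expr0n/= addr0 sqrtr_sqr. Qed.

Lemma gt0_ofR (e : Cplx R) : 0 < e -> exists2 d : R, 0 < d & e = ofR d.
Proof.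
move=> e0; have e_real : e \is Num.real by exact: gtr0_real.
have /complex_realP[d ed] := e_real; exists d => //.
by rewrite -ltcR -ed.
Qed.

Lemma cvg_ofR0 (x : R) : ofR h @[h --> W x] --> (0 : Cplx R).
Proof.
apply/cvgrPdist_lt => e /gt0_ofR[d d0 ->].
apply/near_increment; exists d => // h hd _ _.
by rewrite sub0r normrN norm_ofR ltcR.
Qed.

Lemma Re_mul_ofR (z : Cplx R) (r : R) :
  complex.Re (z * ofR r) = complex.Re z * r.
Proof. by case: z => a b; rewrite /ofR/= mulr0 subr0. Qed.

Section difference_quotients.
Context {p q : nat}.
Implicit Types f g : R -> 'M[Cplx R]_(p, q).

Lemma has_derivative_ge0_cvg f f' (x : R) : has_derivative_ge0 f f' ->
  0 <= x -> f (x + h) @[h --> W x] --> f x.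
Proof.
move=> ff' x0; have fx := ff' x x0.
have : ofR h *: ((ofR h)^-1 *: (f (x + h) - f x)) + f x @[h --> W x]
    --> 0 *: f' x + f x.
  by apply: cvgD; [apply: cvgZ => //; exact: cvg_ofR0|exact: cvg_cst].
rewrite scale0r add0r; apply: cvg_trans; apply: near_eq_cvg.
apply/near_increment; exists 1 => // h _ h0 _.
rewrite scalerA divff ?scale1r ?subrK//.
by apply: contra_neq h0 => /complexI.
Qed.

Lemma has_derivative_ge0_cst (M : 'M[Cplx R]_(p, q)) :
  has_derivative_ge0 (fun=> M) (fun=> 0).
Proof.
move=> x _; under eq_fun do rewrite subrr scaler0.
exact: cvg_cst.
Qed.

Lemma has_derivative_ge0B f f' g g' :
  has_derivative_ge0 f f' -> has_derivative_ge0 g g' ->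
  has_derivative_ge0 (fun x => f x - g x) (fun x => f' x - g' x).
Proof.
move=> ff' gg' x x0.
suff qE h : (ofR h)^-1 *: (f (x + h) - g (x + h) - (f x - g x)) =
    (ofR h)^-1 *: (f (x + h) - f x) - (ofR h)^-1 *: (g (x + h) - g x).
  by under eq_fun do rewrite qE; exact: cvgB (ff' x x0) (gg' x x0).
rewrite -scalerBr; congr (_ *: _).
by rewrite (opprB (f x)) [g x - f x]addrC addrACA opprB [g x - _]addrC.
Qed.

Lemma has_derivative_ge0_trmxC f f' : has_derivative_ge0 f f' ->
  has_derivative_ge0 (fun x => (f x)^t*) (fun x => (f' x)^t*).
Proof.
move=> ff' x x0.
suff qE h : (ofR h)^-1 *: ((f (x + h))^t* - (f x)^t*) =
    ((ofR h)^-1 *: (f (x + h) - f x))^t*.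
  by under eq_fun do rewrite qE; exact: cvg_trmxC _ _ (ff' x x0).
apply/matrixP => i j; rewrite !mxE rmorphM rmorphB fmorphV.
by congr (_^-1 * _); rewrite -[LHS]conjc_real.
Qed.

Lemma eq_has_derivative_ge0 f f' g' : has_derivative_ge0 f f' ->
  (forall x : R, 0 <= x -> f' x = g' x) -> has_derivative_ge0 f g'.
Proof. by move=> ff' fg x x0; rewrite -fg//; exact: ff'. Qed.

Lemma Re_has_derivative_ge0 f f' (c : Cplx R) i j : has_derivative_ge0 f f' ->
  real_derivative_ge0 (fun x => complex.Re (c * f x i j))
                      (fun x => complex.Re (c * f' x i j)).
Proof.
move=> ff' x x0 e e0.
have fij : c * ((ofR h)^-1 * (f (x + h) i j - f x i j)) @[h --> W x]
    --> c * f' x i j.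
  apply: cvgM; first exact: cvg_cst.
  have /cvg_mxP/(_ i j) := ff' x x0.
  by under eq_fun do rewrite !mxE.
have e0' : 0 < ofR e by rewrite ltcR.
have /cvgrPdist_le/(_ _ e0')/near_increment[d d0 Hd] := fij.
exists d => // y y0 yxd.
have [->|yx] := eqVneq y x; first by rewrite !subrr mulr0 subr0 normr0 mulr0.
have := Hd (y - x); rewrite subr_eq0 [x + _]addrC subrK.
move=> /(_ yxd yx y0) H.
have yx0 : ofR (y - x) != 0 by rewrite -subr_eq0 in yx; apply: contra_neq yx => /complexI.
have -> : complex.Re (c * f y i j) - complex.Re (c * f x i j) -
    complex.Re (c * f' x i j) * (y - x) =
    complex.Re (c * f y i j - c * f x i j - c * f' x i j * ofR (y - x)).
  by rewrite !raddfB/= Re_mul_ofR.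
rewrite -lecR; apply: le_trans (normc_ge_Re _) _.
have -> : c * f y i j - c * f x i j - c * f' x i j * ofR (y - x) =
    - (c * f' x i j - c * ((ofR (y - x))^-1 * (f y i j - f x i j))) * ofR (y - x).
  by move: (ofR _) yx0 => r r0; field.
rewrite normrM normrN norm_ofR -/(ofR (e * _)) ofRM.
by apply: ler_wpM2r => //; rewrite ler0c.
Qed.

Lemma has_derivative_ge0_eq0 f : has_derivative_ge0 f (fun=> 0) ->
  forall x : R, 0 <= x -> f x = f 0.
Proof.
move=> f0 x x0; apply/matrixP => i j.
suff Re_eq (c : Cplx R) : complex.Re (c * f x i j) = complex.Re (c * f 0 i j).
  apply/eqP; rewrite eq_complex.
  have := Re_eq 1; rewrite !mul1r => ->; rewrite eqxx/=.
  have := Re_eq 'i%C; rewrite (mulrC _ (f x i j)) (mulrC _ (f 0 i j)) !ReiNIm.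
  move=> /oppr_inj ->.
  by rewrite eqxx.
have Re_le (d : Cplx R) : complex.Re (d * f 0 i j) <= complex.Re (d * f x i j).
  apply: (ge0_derivative_le _ _ (Re_has_derivative_ge0 _ _ d i j f0)) => //.
  by move=> y _; rewrite mxE mulr0.
apply: le_anti; rewrite Re_le andbT.
by have := Re_le (- c); rewrite !mulNr !raddfN/= lerN2.
Qed.

End difference_quotients.

Lemma has_derivative_ge0_mulmx {p q r : nat} (f f' : R -> 'M[Cplx R]_(p, q))
    (g g' : R -> 'M[Cplx R]_(q, r)) :
  has_derivative_ge0 f f' -> has_derivative_ge0 g g' ->
  has_derivative_ge0 (fun x => f x *m g x) (fun x => f' x *m g x + f x *m g' x).
Proof.
move=> ff' gg' x x0.
suff qE h : (ofR h)^-1 *: (f (x + h) *m g (x + h) - f x *m g x) =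
    ((ofR h)^-1 *: (f (x + h) - f x)) *m g (x + h) +
    f x *m ((ofR h)^-1 *: (g (x + h) - g x)).
  under eq_fun do rewrite qE.
  apply: cvgD; apply: cvg_mulmx; [exact: ff'| |exact: cvg_cst|exact: gg'].
  exact: has_derivative_ge0_cvg gg' x0.
rewrite -scalemxAl -scalemxAr -scalerDr; congr (_ *: _).
by rewrite mulmxBl mulmxBr addrA subrK.
Qed.

Lemma has_derivative_ge0_invmx {p : nat} (f f' : R -> 'M[Cplx R]_p) :
  (forall x : R, 0 <= x -> f x \in unitmx) -> has_derivative_ge0 f f' ->
  has_derivative_ge0 (fun x => invmx (f x))
    (fun x => - (invmx (f x) *m f' x *m invmx (f x))).
Proof.
move=> uf ff' x x0.
have : - (invmx (f (x + h)) *m ((ofR h)^-1 *: (f (x + h) - f x)) *m invmx (f x))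
    @[h --> W x] --> - (invmx (f x) *m f' x *m invmx (f x)).
  apply: cvgN; apply: cvg_mulmx; last exact: cvg_cst.
  apply: cvg_mulmx; last exact: ff'.
  by apply: cvg_invmx; [exact: uf|exact: has_derivative_ge0_cvg ff' x0].
apply: cvg_trans; apply: near_eq_cvg.
apply/near_increment; exists 1 => // h _ _ xh0.
rewrite -scalemxAr -scalemxAl -scalerN; congr (_ *: _).
rewrite mulmxBr mulVmx ?uf// mulmxBl mul1mx -mulmxA mulmxV ?uf//.
by rewrite mulmx1 opprB.
Qed.

End derivatives.

Lemma trmxCM {C : numClosedFieldType} {m n p : nat} (A : 'M[C]_(m, n))
  (B : 'M[C]_(n, p)) : (A *m B)^t* = B^t* *m A^t*.
Proof. by rewrite trmx_mul map_mxM. Qed.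

Lemma trmxCK {C : numClosedFieldType} {m n : nat} (A : 'M[C]_(m, n)) :
  (A^t*)^t* = A.
Proof. by apply/matrixP => i j; rewrite !mxE conjCK. Qed.

Lemma trmxC_invmx {C : numClosedFieldType} {n : nat} (A : 'M[C]_n) :
  (invmx A)^t* = invmx (A^t*).
Proof. by rewrite trmx_inv map_invmx. Qed.

Lemma unitmx_trmxC {C : numClosedFieldType} {n : nat} (A : 'M[C]_n) :
  (A^t* \in unitmx) = (A \in unitmx).
Proof. by rewrite map_unitmx unitmx_tr. Qed.

Lemma unitmx_ker {K : fieldType} {n : nat} (A : 'M[K]_n) :
  (forall v : 'cV[K]_n, A *m v = 0 -> v = 0) -> A \in unitmx.
Proof.
move=> kerA; rewrite -unitmx_tr -row_free_unit -kermx_eq0.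
apply: contraT => /rowV0Pn[v /sub_kermxP vA]; apply: contraNT => _.
apply/eqP/trmx_inj; rewrite trmx0; apply: kerA.
by apply: trmx_inj; rewrite trmx_mul trmxK vA trmx0.
Qed.

Lemma hermitian_form_real {R : realType} {n : nat} (M : 'M[Cplx R]_n)
    (v : 'cV[Cplx R]_n) : M^t* = M ->
  (v^t* *m M *m v) 0 0 = ofR (complex.Re ((v^t* *m M *m v) 0 0)).
Proof.
move=> MC; have formC : (v^t* *m M *m v)^t* = v^t* *m M *m v.
  by rewrite !trmxCM trmxCK MC mulmxA.
have trE (N : 'M[Cplx R]_1) : (N^t*) 0 0 = (N 0 0)^* by rewrite !mxE.
by apply/esym/RRe_real/CrealP; rewrite -trE formC.
Qed.

Section posdef.
Context {R : realType} {p : nat}.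
Implicit Types M : 'M[Cplx R]_p.

Lemma posdef_trmxC M : posdef M -> M^t* = M.
Proof.
by case=> /is_hermitianmxP; rewrite expr0 scale1r => /esym.
Qed.

Lemma posdef_ge0 M (v : 'cV[Cplx R]_p) : posdef M -> 0 <= (v^t* *m M *m v) 0 0.
Proof.
case=> _ M0; have [->|/M0/ltW//] := eqVneq v 0.
by rewrite mulmx0 mxE.
Qed.

Lemma posdef_unitmx M : posdef M -> M \in unitmx.
Proof.
move=> [_ M0]; apply: unitmx_ker => v Mv; apply/eqP; apply: contraT => /M0.
by rewrite -mulmxA Mv mulmx0 mxE ltxx.
Qed.

End posdef.

Lemma jmx_trmxC {R : realType} {m1 m2 : nat} : (jmx R m1 m2)^t* = jmx R m1 m2.
Proof.
rewrite /jmx tr_block_mx map_block_mx !trmx0 linearN/= !trmx1.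
by rewrite !map_mx0 map_mxN !map_mx1.
Qed.

Lemma jmx_sqr {R : realType} {m1 m2 : nat} : jmx R m1 m2 *m jmx R m1 m2 = 1%:M.
Proof.
rewrite /jmx mulmx_block !mulmx0 !mul0mx !addr0 add0r mulNmx mulmxN opprK.
by rewrite !mulmx1 -scalar_mx_block.
Qed.

Lemma lim_involution {K : numFieldType} {V : normedModType K} (c : V -> V)
    (u : nat -> V) : continuous c -> involutive c -> c point = point ->
  limn (c \o u) = c (limn u).
Proof.
move=> cc ci cp; have [cu|ncu] := pselect (cvgn u).
  apply: cvg_lim; first exact: norm_hausdorff.
  exact: (cvg_comp u c cu (cc _)).
rewrite (dvgP ncu) dvgP// => ccu; apply: ncu; apply/cvg_ex.
exists (c (limn (c \o u))).
have := cvg_comp (c \o u) c ccu (cc _).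
by have -> : c \o (c \o u) = u by apply/funext => x /=; rewrite ci.
Qed.

Lemma trmxCX {C : numClosedFieldType} {n : nat} (A : 'M[C]_n) k :
  (A ^+ k)^t* = (A^t*) ^+ k.
Proof.
elim: k => [|k IH]; first by rewrite !expr0 trmx1 map_mx1.
by rewrite exprS exprSr trmxCM IH.
Qed.

Lemma trmxC_sum {C : numClosedFieldType} {m n : nat} (I : Type) (r : seq I)
    (f : I -> 'M[C]_(m, n)) :
  (\sum_(i <- r) f i)^t* = \sum_(i <- r) (f i)^t*.
Proof.
apply: (big_morph (fun A : 'M[C]_(m, n) => A^t*)) => [A B|].
  by rewrite linearD map_mxD.
by rewrite trmx0 map_mx0.
Qed.

Lemma trmxCZ {C : numClosedFieldType} {m n : nat} (c : C) (A : 'M[C]_(m, n)) :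
  (c *: A)^t* = c^* *: A^t*.
Proof. by rewrite linearZ map_mxZ. Qed.

(* Convergence of the series is not needed: a divergent limit is the junk value
   0, which conjugation fixes. *)
Lemma expmx_trmxC {R : realType} {p : nat} (M : 'M[Cplx R]_p) :
  expmx (M^t*) = (expmx M)^t*.
Proof.
rewrite /expmx -(lim_involution (fun N => N^t*)); first last.
- by apply/matrixP => i j; rewrite !mxE; exact: conjC0.
- exact: trmxCK.
- by move=> N; apply: (cvg_trmxC (F := nbhs N) id N); exact: cvg_id.
congr (limn _); apply/funext => k; rewrite /series [RHS]trmxC_sum.
apply: eq_bigr => l _; rewrite trmxCZ trmxCX; congr (_ *: _).
by rewrite fmorphV; congr (_^-1); exact: esym (rmorph_nat _ _).
Qed.

Lemma has_derivative_ge0_sandwich {R : realType} {p q r s : nat}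
    (B : 'M[Cplx R]_(p, q)) (C : 'M[Cplx R]_(r, s))
    (f f' : R -> 'M[Cplx R]_(q, r)) : has_derivative_ge0 f f' ->
  has_derivative_ge0 (fun x => B *m f x *m C) (fun x => B *m f' x *m C).
Proof.
move=> ff'.
have dBf := has_derivative_ge0_mulmx _ _ _ _ (has_derivative_ge0_cst B) ff'.
have := has_derivative_ge0_mulmx _ _ _ _ dBf (has_derivative_ge0_cst C).
move/eq_has_derivative_ge0; apply => x _.
by rewrite mul0mx add0r mulmx0 addr0.
Qed.

Lemma Re_ge0 {R : realType} (z : Cplx R) : 0 <= z -> 0 <= complex.Re z.
Proof. by rewrite lecE => /andP[]. Qed.

Lemma skew_of_hermitian {C : numClosedFieldType} {m : nat} (J P H : 'M[C]_m) :
  J^t* = J -> J *m J = 1%:M -> P^t* = P -> H^t* = H ->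
  (J *m P *m J *m H - J *m H *m J *m P)^t* *m J +
  J *m (J *m P *m J *m H - J *m H *m J *m P) = 0.
Proof.
move=> JC J2 PC HC.
have JJ p (B : 'M[C]_(p, m)) : B *m J *m J = B by rewrite -mulmxA J2 mulmx1.
rewrite linearB map_mxB !trmxCM PC JC HC.
rewrite mulmxBl mulmxBr !mulmxA !JJ J2 !mul1mx.
by rewrite addrC addrA subrK subrr.
Qed.

Section canonical_system.
Context {R : realType} {n m1 m2 : nat}.
Notation J := (jmx R m1 m2).
Variables (H : R -> 'M[Cplx R]_(m1 + m2)) (Pi : R -> 'M[Cplx R]_(n, m1 + m2)).
Variables (S : R -> 'M[Cplx R]_n) (u : R -> 'M[Cplx R]_(m1 + m2)).
Hypothesis hH : forall x : R, 0 <= x -> posdef (H x).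
Hypothesis hS0 : posdef (S 0).
Hypothesis hS : has_derivative_ge0 S
  (fun x => Pi x *m J *m H x *m J *m (Pi x)^t*).
Hypothesis hu : has_derivative_ge0 u (fun x => - (q0_tilde H Pi S x) *m u x).
Hypothesis hu0 : u 0 = 1%:M.

Let H_trmxC (x : R) : 0 <= x -> (H x)^t* = H x.
Proof. by move=> x0; exact: posdef_trmxC (hH x x0). Qed.

Lemma S_trmxC (x : R) : 0 <= x -> (S x)^t* = S x.
Proof.
move=> x0; apply/esym/eqP; rewrite -subr_eq0; apply/eqP.
have := has_derivative_ge0B _ _ _ _ hS (has_derivative_ge0_trmxC _ _ hS).
move/(eq_has_derivative_ge0 _ _ (fun=> 0)) => S0.
rewrite (has_derivative_ge0_eq0 _ (S0 _) x x0).
  by rewrite (posdef_trmxC _ hS0) subrr.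
move=> y y0; apply/eqP; rewrite subr_eq0; apply/eqP.
by rewrite !trmxCM trmxCK jmx_trmxC H_trmxC// !mulmxA.
Qed.

Lemma dS_ge0 (x : R) (v : 'cV[Cplx R]_n) : 0 <= x ->
  0 <= (v^t* *m (Pi x *m J *m H x *m J *m (Pi x)^t*) *m v) 0 0.
Proof.
move=> x0.
have := posdef_ge0 (H x) (J *m (Pi x)^t* *m v) (hH x x0).
by rewrite !trmxCM trmxCK jmx_trmxC !mulmxA.
Qed.

Lemma S_unitmx (x : R) : 0 <= x -> S x \in unitmx.
Proof.
move=> x0; apply: unitmx_ker => v Sv; apply/eqP; apply: contraT => v0.
pose z y := (v^t* *m S y *m v) 0 0.
have : complex.Re (1 * z 0) <= complex.Re (1 * z x).
  have dz := has_derivative_ge0_sandwich (v^t*) v _ _ hS.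
  apply: (ge0_derivative_le _ _ (Re_has_derivative_ge0 _ _ 1 0 0 dz)) => //.
  by move=> y /andP[y0 _]; rewrite mul1r; apply: Re_ge0; exact: dS_ge0.
have -> : z x = 0 by rewrite /z -mulmxA Sv mulmx0 mxE.
have : 0 < z 0 by exact: hS0.2.
by move: (z 0) => w; rewrite mul1r mulr0 ltcE => /andP[_] /lt_geF ->.
Qed.

Lemma q0_tilde_skew (x : R) : 0 <= x ->
  (q0_tilde H Pi S x)^t* *m J + J *m q0_tilde H Pi S x = 0.
Proof.
move=> x0; pose P := (Pi x)^t* *m invmx (S x) *m Pi x.
have PC : P^t* = P.
  by rewrite /P !trmxCM trmxCK trmxC_invmx S_trmxC// mulmxA.
have -> : q0_tilde H Pi S x = J *m P *m J *m H x - J *m H x *m J *m P.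
  by rewrite /q0_tilde /P !mulmxA.
by rewrite skew_of_hermitian ?H_trmxC//; [exact: jmx_trmxC|exact: jmx_sqr].
Qed.

Lemma u_j_unitary (x : R) : 0 <= x -> (u x)^t* *m J *m u x = J.
Proof.
move=> x0.
have duJ := has_derivative_ge0_mulmx _ _ _ _ (has_derivative_ge0_trmxC _ _ hu)
  (has_derivative_ge0_cst J).
have := has_derivative_ge0_mulmx _ _ _ _ duJ hu.
move/(eq_has_derivative_ge0 _ _ (fun=> 0)) => uJu0.
rewrite (has_derivative_ge0_eq0 _ (uJu0 _) x x0).
  by rewrite hu0 trmx1 map_mx1 mul1mx mulmx1.
move=> y y0; transitivity (- ((u y)^t* *m ((q0_tilde H Pi S y)^t* *m J +
    J *m q0_tilde H Pi S y) *m u y)).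
  rewrite mulmx0 addr0 trmxCM linearN map_mxN mulmxDr mulmxDl.
  by rewrite !(mulNmx, mulmxN) !mulmxA opprD.
by rewrite q0_tilde_skew// mulmx0 mul0mx oppr0.
Qed.

Lemma u_unitmx (x : R) : 0 <= x -> u x \in unitmx.
Proof.
move=> x0; apply: unitmx_ker => v uv.
have := congr1 (mulmx^~ v) (u_j_unitary x x0).
rewrite -(mulmxA _ (u x)) uv mulmx0 => /(congr1 (mulmx J)).
by rewrite mulmx0 mulmxA jmx_sqr mul1mx.
Qed.

Notation dSinv x := (invmx (S x) *m (Pi x *m J *m H x *m J *m (Pi x)^t*)
  *m invmx (S x)).

Lemma calH_form (A : 'M[Cplx R]_n) (t x : R) (h : 'cV[Cplx R]_n) : 0 <= x ->
  let y := Ymx A H u Pi S x t *m h in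
  let b := expmx (('i * ofR t) *: A) *m h in
  y^t* *m calH H u x *m y = b^t* *m dSinv x *m b.
Proof.
move=> x0 y b; pose z := H x *m J *m (Pi x)^t* *m invmx (S x) *m b.
have -> : y = (u x)^t* *m z by rewrite /y /Ymx /z /b !mulmxA.
have uC : (u x)^t* \in unitmx by rewrite unitmx_trmxC u_unitmx.
rewrite /calH trmxCM trmxCK -!mulmxA mulKVmx ?u_unitmx// mulKmx//.
have -> : invmx (H x) *m z = J *m (Pi x)^t* *m invmx (S x) *m b.
  by rewrite /z -!mulmxA mulKmx//; exact: posdef_unitmx (hH x x0).
rewrite /z !trmxCM trmxC_invmx S_trmxC// trmxCK jmx_trmxC H_trmxC//.
by rewrite !mulmxA.
Qed.

Lemma dSinv_ge0 (x : R) (b : 'cV[Cplx R]_n) : 0 <= x ->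
  0 <= (b^t* *m dSinv x *m b) 0 0.
Proof.
move=> x0; have := dS_ge0 x (invmx (S x) *m b) x0.
by rewrite trmxCM trmxC_invmx S_trmxC// !mulmxA.
Qed.

Lemma Sinv_derivative (b : 'cV[Cplx R]_n) : has_derivative_ge0
  (fun x => b^t* *m invmx (S x) *m b) (fun x => - (b^t* *m dSinv x *m b)).
Proof.
have := has_derivative_ge0_sandwich (b^t*) b _ _
  (has_derivative_ge0_invmx _ _ S_unitmx hS).
by move/eq_has_derivative_ge0; apply => x _; rewrite mulmxN mulNmx.
Qed.

End canonical_system.

Theorem proposition3p1 (R : realType) (n m1 m2 : nat) (hm : (0 < m1 + m2)%N)
    (H : R -> 'M[Cplx R]_(m1 + m2))
    (hH : forall x : R, 0 <= x -> posdef (H x))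
    (A : 'M[Cplx R]_n)
    (Pi : R -> 'M[Cplx R]_(n, m1 + m2))
    (S : R -> 'M[Cplx R]_n)
    (u : R -> 'M[Cplx R]_(m1 + m2))
    (hS0 : posdef (S 0))
    (hA : A *m S 0 - S 0 *m A^t* = 'i *: (Pi 0 *m jmx R m1 m2 *m (Pi 0)^t*))
    (hPi : has_derivative_ge0 Pi
             (fun x => - 'i *: (A *m Pi x *m jmx R m1 m2 *m H x)))
    (hS : has_derivative_ge0 S
            (fun x => Pi x *m jmx R m1 m2 *m H x *m jmx R m1 m2 *m (Pi x)^t*))
    (hu : has_derivative_ge0 u (fun x => - (q0_tilde H Pi S x) *m u x))
    (hu0 : u 0 = 1%:M)
    (t a : R) (ha : 0 <= a) (h : 'cV[Cplx R]_n) :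
  lebesgue_measure.-integrable `[0, a]
    (EFin \o energy_density (calH H u) (fun x => Ymx A H u Pi S x t *m h)) /\
  ofR (energy a (calH H u) (fun x => Ymx A H u Pi S x t *m h)) =
  sqrtC ((h^t* *m expmx ((- 'i * ofR t) *: A^t*)
            *m (invmx (S 0) - invmx (S a))
            *m expmx (('i * ofR t) *: A) *m h) 0 0).
Proof.
pose b := expmx (('i * ofR t) *: A) *m h.
pose g (x : R) := b^t* *m (invmx (S x) *m (Pi x *m jmx R m1 m2 *m H x *m
  jmx R m1 m2 *m (Pi x)^t*) *m invmx (S x)) *m b.
pose F (x : R) := complex.Re (-1 * (b^t* *m invmx (S x) *m b) 0 0).
pose dF (x : R) := complex.Re (-1 * (- g x) 0 0).
have FdF : real_derivative_ge0 F dF.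
  exact: Re_has_derivative_ge0 (Sinv_derivative _ _ _ hH hS0 hS b).
have dFE x : dF x = complex.Re (g x 0 0) by rewrite /dF mxE mulN1r opprK.
have dF0 (x : R) : 0 <= x <= a -> 0 <= dF x.
  move=> /andP[x0 _]; rewrite dFE.
  by apply: Re_ge0; exact: (dSinv_ge0 _ _ _ hH hS0 hS).
have densE (x : R) : 0 <= x <= a ->
    energy_density (calH H u) (fun x => Ymx A H u Pi S x t *m h) x = dF x.
  move=> /andP[x0 _]; rewrite dFE /energy_density.
  by rewrite (calH_form _ _ _ _ hH hS0 hS hu hu0 A t x h x0).
split.
  apply: (eq_integrable _ _ _ _ (ge0_derivative_integrable F dF FdF a ha dF0)).
    exact: measurable_itv.
  by move=> x; rewrite inE/= in_itv/= => /densE ->.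
rewrite /energy.
have -> : \int[lebesgue_measure]_(x in `[0, a]) energy_density (calH H u)
    (fun x => Ymx A H u Pi S x t *m h) x = F a - F 0.
  rewrite /Rintegral -[RHS]/(fine (F a - F 0)%:E).
  rewrite -(ge0_derivative_integral F dF FdF a ha dF0); congr fine.
  by apply: eq_integral => x; rewrite inE/= in_itv/= => /densE ->.
have Fle : 0 <= F a - F 0.
  by rewrite subr_ge0 (ge0_derivative_le F dF).
have bE : h^t* *m expmx ((- 'i * ofR t) *: A^t*) = b^t*.
  have -> : (- 'i * ofR t) *: A^t* = (('i * ofR t) *: A)^t*.
    rewrite trmxCZ; congr (_ *: _); apply/esym; transitivity ('i^* * (ofR t)^*).
      exact: rmorphM.
    by rewrite conjCi; congr (_ * _); exact: conjc_real.
  by rewrite expmx_trmxC -trmxCM.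
rewrite bE -(mulmxA _ _ h) -/b mulmxBr mulmxBl.
have FE (x : R) : 0 <= x -> ofR (F x) = - (b^t* *m invmx (S x) *m b) 0 0.
  move=> x0; rewrite hermitian_form_real.
    by rewrite /F mulN1r raddfN; exact: (rmorphN (real_complex R)).
  by rewrite trmxC_invmx (S_trmxC _ _ _ hH hS0 hS).
have -> : (b^t* *m invmx (S 0) *m b - b^t* *m invmx (S a) *m b) 0 0 =
    ofR (F a - F 0).
  rewrite [LHS]mxE [X in _ + X]mxE.
  transitivity (ofR (F a) - ofR (F 0)); last first.
    exact: esym (rmorphB (real_complex R) _ _).
  have subE (c d w z : Cplx R) : c = - w -> d = - z -> z - w = c - d.
    by move=> -> ->; rewrite opprK addrC.
  exact: subE (FE a ha) (FE 0 (lexx 0)).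
rewrite -[in RHS](sqr_sqrtr Fle) expr2 ofRM -expr2 sqrCK//.
by rewrite ler0c sqrtr_ge0.
Qed.
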